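(* Let $(X,d,T)$ be a topological dynamical system and $\mu\in M(X,T)$. If for any $\epsilon>0$ there exists a (measurable) subset $A\subset X$ with $\mu(A)>1-\epsilon$ such that the induced system $(A,\mu_A,T_A)$ has discrete spectrum, then $(X,\mu,T)$ is $\mu$-$FK$-equicontinuous.
   Context: A topological dynamical system $(X,d,T)$ consists of a compact metric space $X$ with metric $d$ and a continuous map $T:X\to X$. $M(X,T)$ is the set of all $T$-invariant Borel probability measures on $X$. The measure $\mu$ is not assumed ergodic. For $x,y\in X$, $\delta>0$ and $n\in\mathbb{N}$, an $(n,\delta)$-match of $x$ and $y$ is an order preserving bijection $\pi:D(\pi)\to R(\pi)$ (i.e. $\pi(i)<\pi(j)$ whenever $i<j$) with $D(\pi),R(\pi)\subset\{0,1,\ldots,n-1\}$ such that $d(T^ix,T^{\pi(i)}y)<\delta$ for every $i\in D(\pi)$. Let $|\pi|$ be the cardinality of $D(\pi)$. Set $$\bar f_{n,\delta}(x,y)=1-\frac{\max\{|\pi|:\pi\text{ is an }(n,\delta)\text{-match of }x\text{ and }y\}}{n},\qquad \bar f_\delta(x,y)=\limsup_{n\to+\infty}\bar f_{n,\delta}(x,y),$$ $$d_{FK}(x,y)=\inf\{\delta>0:\bar f_\delta(x,y)<\delta\}.$$ $(X,T)$ (equivalently written $(X,\mu,T)$) is $\mu$-$FK$-equicontinuous if for every $\tau>0$ there exists a compact set $M\subset X$ with $\mu(M)>1-\tau$ such that for every $\epsilon>0$ there exists $\delta>0$ such that for all $x,y\in M$, $d(x,y)<\delta$ implies $d_{FK}(x,y)<\epsilon$.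 For measurable $A\subset X$ with $\mu(A)>0$, the induced system $(A,\mu_A,T_A)$ is given by $\mu_A(B)=\mu(B)/\mu(A)$ for measurable $B\subset A$ and $T_A(x)=T^{r_A(x)}(x)$ for ($\mu$-a.e.) $x\in A$, where $r_A(x)=\min\{n\ge1:T^nx\in A\}$. A measure-preserving system has discrete spectrum if the eigenfunctions of its Koopman operator span a dense subspace of $L^2$. *)

(* Defs.v *)
(* MathComp-Analysis, with R[i] from mathcomp-real-closed. *)
From HB Require Import structures.
From mathcomp Require Import all_boot all_order all_algebra.
From mathcomp Require Import complex.
From mathcomp Require Import all_classical all_reals all_analysis.

Set Implicit Arguments.
Unset Strict Implicit.
Unset Printing Implicit Defensive.

Import Order.TTheory GRing.Theory Num.Theory.
Import numFieldNormedType.Exports.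

Local Open Scope classical_set_scope.
Local Open Scope ring_scope.

(* Every measurableType is pointed.  A space that carries a probability measure
   is nonempty, so asking for a base point loses no generality. *)
#[short(type="pmetricType")]
HB.structure Definition PMetric (K : numDomainType) :=
  {M of Pointed M & Metric K M}.

Definition borel (R : realType) (X : pmetricType R) :=
  g_sigma_algebraType (@open X).

(** Feldman-Katok pseudometric *)

Section FeldmanKatok.
Context (R : realType) (X : pmetricType R) (T : X -> X).

(* A match with domain D and range p @: D; p is irrelevant outside D.  An order
   preserving p is injective on D, hence a bijection from D onto p @: D. *)
Definition is_match (n : nat) (delta : R) (x y : X)
    (D : {set 'I_n}) (p : {ffun 'I_n -> 'I_n}) : bool :=
  [forall i in D, forall j in D, (i < j)%N ==> (p i < p j)%N] &&
  [forall i in D, mdist (iter i T x) (iter (p i) T y) < delta].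

Definition max_match (n : nat) (delta : R) (x y : X) : nat :=
  \max_(m : {set 'I_n} * {ffun 'I_n -> 'I_n} | is_match delta x y m.1 m.2)
    #|m.1|.

Definition fbar_n (n : nat) (delta : R) (x y : X) : R :=
  1 - (max_match n delta x y)%:R / n%:R.

Definition fbar (delta : R) (x y : X) : R :=
  limn_sup (fun n => fbar_n n delta x y).

Definition d_FK (x y : X) : R :=
  inf [set delta : R | 0 < delta /\ fbar delta x y < delta].

End FeldmanKatok.

Definition invariant_measure (R : realType) (X : pmetricType R) (T : X -> X)
    (mu : probability (borel X) R) : Prop :=
  forall B : set (borel X), measurable B -> mu (T @^-1` B) = mu B.

Definition FK_equicontinuous (R : realType) (X : pmetricType R) (T : X -> X)
    (mu : probability (borel X) R) : Prop :=
  forall tau : R, 0 < tau ->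
  exists M : set X, [/\ compact M, ((1 - tau)%:E < mu M)%E &
    forall eps : R, 0 < eps -> exists2 delta : R, 0 < delta &
    forall x y : X, M x -> M y -> mdist x y < delta -> d_FK T x y < eps].

(** Discrete spectrum *)

Section DiscreteSpectrum.
Context (R : realType) (d : measure_display) (Y : measurableType d).
Context (nu : probability Y R) (S : Y -> Y).

Definition L2norm (f : Y -> R[i]) : \bar R :=
  Lnorm nu 2%:E (fun x => (Normc.normc (f x))%:E).

(* Complex L^2, by representatives rather than almost-everywhere classes. *)
Definition L2 : set (Y -> R[i]) := [set f |
  [/\ measurable_fun [set: Y] (fun x => complex.Re (f x)),
      measurable_fun [set: Y] (fun x => complex.Im (f x)) &
      (L2norm f < +oo)%E]].

(* Eigenfunctions of the Koopman operator f |-> f \o S. *)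
Definition eigenfunction (f : Y -> R[i]) : Prop :=
  [/\ L2 f, ~ {ae nu, forall x, f x = 0} &
      exists lambda : R[i], {ae nu, forall x, f (S x) = lambda * f x}].

Definition discrete_spectrum : Prop :=
  forall g : Y -> R[i], L2 g -> forall eps : R, 0 < eps ->
  exists (n : nat) (c : 'I_n -> R[i]) (e : 'I_n -> Y -> R[i]),
    (forall k, eigenfunction (e k)) /\
    (L2norm (fun x => (g x - \sum_(k < n) c k * e k x)%R) < eps%:E)%E.

End DiscreteSpectrum.

(** Induced system.
   It is carried by the whole space: the induced measure satisfies
   mu_A (~` A) = 0, so L^2(A, mu_A) is L^2(X, mu_A), and the values of the
   induced map outside A are irrelevant. *)

Section Induced.
Context (R : realType) (X : pmetricType R) (T : X -> X).

(* min {n >= 1 | T^n x \in A}, and 0 if x never returns to A. *)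
Definition return_time (A : set X) (x : X) : nat :=
  xget 0%N [set n | [/\ (0 < n)%N, A (iter n T x) &
    forall m, (0 < m)%N -> A (iter m T x) -> (n <= m)%N]].

Definition induced_map (A : set X) (x : X) : X := iter (return_time A x) T x.

(* B |-> mu (B `&` A) / mu A when mu A > 0; the default value mu of mnormalize
   is used only if mu A = 0. *)
Definition induced_measure (mu : probability (borel X) R)
    (A : set (borel X)) (mA : measurable A) : probability (borel X) R :=
  mnormalize (mrestr mu mA) mu.

End Induced.

(* Main.v *)
Require Import Defs.
From mathcomp Require Import all_boot all_order all_algebra.
From mathcomp Require Import complex lra.
From mathcomp Require Import all_classical all_reals all_analysis.
From mathcomp Require Import measurable_realfun.
Import Order.TTheory GRing.Theory Num.Theory.
Import numFieldNormedType.Exports.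
Local Open Scope classical_set_scope.
Local Open Scope ring_scope.

(** Write [S] for the map induced by [T] on [A].  If [f] is an eigenfunction of
    [S] with eigenvalue [l], then [|l| <= 1], so that
    [|f (S^i x) - f (S^i y)| <= |f x - f y|] for all [i]: the values of [f] stay
    close along the two orbits for ever, once they are close at time 0.

    Choose a bounded measurable function [phi] such that
    [|phi z - phi z'| < 1] forces [z] and [z'] to be within [eps]
    ([exists_code]), and, by discrete spectrum, a finite combination [g] of
    eigenfunctions that is L^2-close to [phi] on [A].  Let [G] be the part of [A]
    where [|phi - g| < 1/4]; Chebyshev's inequality makes the complement of [G]
    small.  Let [x] and [y] be points at which the eigenfunctions occurring in [g]
    take close values.  If the orbits of [x] and of [y] both lie in [G] at their
    [i]-th visit to [A], then [g] differs little at these two points, hence so does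
    [phi], hence the two points are within [eps].  So an [(n, eps)]-match of [x]
    and [y] is obtained by sending the time of the [i]-th visit of [x] to [A] to
    the time of the [i]-th visit of [y], whenever both visits are in [G]
    ([visits_max_match]).  It omits at most as many times as the two orbits spend
    outside [G] before time [n].

    The proportion of time spent outside [G] depends on the orbit; it is controlled
    as follows: the set of points whose orbit spends, up to some time, more than a
    proportion [k] outside [G] has measure at most [mu (~` G) / k].  This is the maximal ergodic inequality
    ([maximal_ergodic_inequality]), proved here for indicator functions by a
    covering argument.  The bound [|l| <= 1] is a form of Poincare recurrence: if
    [|l| > 1], then [|f|] is multiplied by a factor at least [|l|] between two
    visits to [A], so that [{|f| < q < |l| |f|}] is, in [A] and up to a null set, a
    wandering set for every rational [q], hence null ([eigenvalue_le1]).

    Finally, closeness of the eigenfunctions at [x] and [y] must follow from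
    [mdist x y < delta].  By Lusin's theorem ([nearly_continuous]) this is so on a
    closed set of measure arbitrarily close to 1, by compactness.  The properties
    of closed sets that are needed (for each of the eigenfunctions, and then for
    each [eps] in a sequence tending to 0) all hold up to arbitrarily small
    measure and are inherited by subsets, so that countably many of them can be
    imposed at once ([nearly_all]). *)

Set Implicit Arguments.
Unset Strict Implicit.
Unset Printing Implicit Defensive.

Local Notation normc := Normc.normc.

(** * Regularity of Borel probabilities and Lusin's theorem *)

Definition nearly (R : realType) (X : pmetricType R)
    (mu : probability (borel X) R) (P : set X -> Prop) : Prop :=
  forall tau : R, 0 < tau ->
  exists M : set (borel X), [/\ closed (M : set X), (mu (~` M) <= tau%:E)%E & P M].

Section Regularity.
Context {R : realType} {X : pmetricType R} (mu : probability (borel X) R).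

Lemma open_measurable_borel (O : set (borel X)) : open (O : set X) -> measurable O.
Proof. by move=> oO; exact: sub_sigma_algebra. Qed.

Lemma closed_measurable_borel (C : set (borel X)) :
  closed (C : set X) -> measurable C.
Proof.
move=> cC; rewrite -[C]setCK; apply: measurableC; apply: open_measurable_borel.
exact: closed_openC.
Qed.

Lemma vanishing_measure (D : nat -> set (borel X)) (tau : R) :
  (forall n, measurable (D n)) ->
  (forall n m, (n <= m)%N -> D m `<=` D n) -> \bigcap_n D n = set0 ->
  0 < tau -> exists N, (mu (D N) <= tau%:E)%E.
Proof.
move=> mD decD D0 tau0.
have mI : measurable (\bigcap_n D n) by exact: bigcap_measurable.
have := @nonincreasing_cvg_mu _ _ _ mu D _ mD mI.
rewrite D0 measure0 => /(_ _ _)/fine_cvgP[||fin].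
- exact: le_lt_trans (probability_le1 _ (mD _)) (ltry _).
- by move=> n m nm; apply/subsetPset/decD.
move=> /cvgrPdist_le /(_ _ tau0) [N _ /(_ _ (leqnn N))].
rewrite /= sub0r normrN => h; exists N.
have fN : mu (D N) \is a fin_num by exact: fin_num_measure.
rewrite -(fineK fN) lee_fin; exact: le_trans (ler_norm _) h.
Qed.

(** The exceptional sets are given measures [tau / 2 ^ n.+1], which sum to [tau]. *)
Lemma nearly_all (I : countType) (P : I -> set X -> Prop) :
  (forall i (M M' : set X), M' `<=` M -> P i M -> P i M') ->
  (forall i, nearly mu (P i)) -> nearly mu (fun M => forall i, P i M).
Proof.
move=> Panti nP tau tau0.
have tau2 n : 0 < tau / (2 ^ n.+1)%:R by rewrite divr_gt0// ltr0n expn_gt0.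
have /choice[M HM] : forall n : nat, exists M : set (borel X),
    [/\ closed (M : set X), (mu (~` M) <= (tau / (2 ^ n.+1)%:R)%:E)%E &
      forall i : I, unpickle n = Some i -> P i M].
  move=> n; case E : (unpickle n : option I) => [i|].
    have [M [cM muM PM]] := nP i _ (tau2 n).
    by exists M; split => // j [<-].
  exists setT; split => //.
  by rewrite setCT measure0 lee_fin ltW.
exists (\bigcap_n M n); split.
- by apply: closed_bigI => n _; have [] := HM n.
- rewrite setC_bigcap.
  apply: le_trans (epsilon_trick0 xpredT (ltW tau0)).
  have mCM n : measurable (~` M n).
    by apply: measurableC; apply: closed_measurable_borel; have [] := HM n.
  apply: le_trans.
    apply: (@measure_sigma_subadditive _ _ _ mu _ (fun n => ~` M n)) => //.
    exact: bigcup_measurable.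
  by apply: lee_nneseries => n _ //; have [] := HM n.
- move=> i; apply: (Panti i (M (pickle i))); first exact: bigcap_inf.
  by have [_ _] := HM (pickle i); apply; exact: pickleK.
Qed.

(** Membership in [B] is a continuous function on the subspace [M], i.e. the trace
    of [B] on [M] is relatively clopen. *)
Definition locally_constant_on (M B : set X) : Prop :=
  forall x, M x -> \forall y \near x, M y -> (B y <-> B x).

Lemma locally_constant_onS (B M M' : set X) :
  M' `<=` M -> locally_constant_on M B -> locally_constant_on M' B.
Proof. by move=> sM lM x /sM /lM; apply: filterS => y By /sM. Qed.

(** The open set [O] is the union of the closed sets [F n] of points at distance at
    least [n.+1%:R^-1] from its complement; discard [O `\` F n] for a large [n]. *)
Lemma nearly_locally_constant_open (O : set X) :
  open O -> nearly mu (fun M => locally_constant_on M O).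
Proof.
move=> oO tau tau0.
pose F n : set X := [set x | ball x n.+1%:R^-1 `<=` O].
have cF n : closed (F n).
  move=> x clx y xy; rewrite ballEmdist /= in xy.
  have r0 : 0 < n.+1%:R^-1 - mdist x y by rewrite subr_gt0.
  have [z [Fz xz]] := clx _ (nbhsx_ballx x _ r0).
  apply: Fz; rewrite ballEmdist /=.
  rewrite ballEmdist /= in xz.
  have := metric_triangle z x y; rewrite (metric_sym z x) => /le_lt_trans; apply.
  by rewrite -ltrBrDr.
have mF n : measurable (F n : set (borel X)) by exact: closed_measurable_borel.
have mO : measurable (O : set (borel X)) by exact: open_measurable_borel.
have [|||N muN] := @vanishing_measure (fun n : nat => O `\` F n) tau _ _ _ tau0.
- by move=> n; exact: measurableD.
- move=> n m nm x [Ox nFx]; split => // Fx; apply: nFx => y xy; apply: Fx.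
  by apply: le_ball xy; rewrite lef_pV2 ?posrE ?ltr0n// ler_nat ltnS.
- apply/seteqP; split => // x xD.
  have [Ox _] := xD 0%N I.
  have /nbhs_ballP[r /= r0 xr] : nbhs (x : X) O by exact: open_nbhs_nbhs.
  have [n _ nr] := near_infty_natSinv_lt (PosNum r0).
  have [_] := xD n I; apply => y xy; apply: xr; apply: le_ball xy.
  by apply/ltW; exact: (nr n (leqnn n)).
exists (~` O `|` F N); split.
- by apply: closedU; [exact: open_closedC|exact: cF].
- by rewrite setCU setCK.
- have FO : F N `<=` O by move=> y; apply; apply: ballxx; rewrite invr_gt0 ltr0n.
  move=> x [nOx|Fx].
    have : nbhs x (~` F N).
      by apply: open_nbhs_nbhs; split; [exact: closed_openC|move=> /FO].
    by apply: filterS => y nFy [//|//].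
  have : nbhs x O by apply: open_nbhs_nbhs; split => //; exact: FO.
  by apply: filterS => y Oy _; split => // _; exact: FO.
Qed.

(** Borel sets can be treated by induction on the generated sigma-algebra, because
    this property, unlike inner regularity alone, is visibly stable under
    complement.  For a countable union, first make all the [B_ n] relatively clopen
    in a closed [M]; the trace on [M] of a tail
    [D N = \bigcup_n B_ n `\` \bigcup_(n < N) B_ n] is then relatively open, so
    that [M `\` D N] is still closed, and on it the union is a finite one. *)
Lemma nearly_locally_constant (B : set (borel X)) :
  measurable B -> nearly mu (fun M => locally_constant_on M B).
Proof.
pose G : set (set X) :=
  [set B | measurable (B : set (borel X)) /\ nearly mu (fun M => locally_constant_on M B)].
suff sG : <<s @open X >> `<=` G by move=> /sG[].
apply: smallest_sub; last first.
  by move=> O oO; split; [exact: open_measurable_borel|exact: nearly_locally_constant_open].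
split.
- by split=> //; apply: nearly_locally_constant_open; exact: open0.
- move=> A [mA nA]; rewrite setTD; split; first exact: measurableC.
  move=> tau /nA[M [cM muM lM]]; exists M; split => // x /lM.
  by apply: filterS => y h My; have [h1 h2] := h My; split => nA' /= ?; apply: nA'; auto.
move=> B_ GB; split; first by apply: (@bigcupT_measurable _ (borel X)) => n; have [] := GB n.
have mB n : measurable (B_ n : set (borel X)) by have [] := GB n.
move=> tau tau0.
have tau20 : 0 < tau / 2 by rewrite divr_gt0.
have [||M [cM muM lM]] := @nearly_all nat (fun n M => locally_constant_on M (B_ n)) _ _ _ tau20.
- by move=> n M M'; exact: locally_constant_onS.
- by move=> n; have [] := GB n.
pose U N := \bigcup_(n in [set k | (k < N)%N]) B_ n.
pose D N : set (borel X) := (\bigcup_n B_ n) `\` U N.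
have mD N : measurable (D N).
  by apply: measurableD; exact: bigcup_measurable.
have [|||N muN] := @vanishing_measure D (tau / 2) _ _ _ tau20.
- exact: mD.
- move=> n m nm x [Bx nUx]; split => // -[k /= kn Bk]; apply: nUx; exists k => //=.
  exact: leq_trans nm.
- apply/seteqP; split => // x xD.
  have [[k _ Bk] _] := xD 0%N I.
  by have [_] := xD k.+1 I; apply; exists k => /=.
have lU : locally_constant_on M (U N).
  move=> x Mx.
  have : \forall y \near x, forall i : 'I_N, M y -> (B_ i y <-> B_ i x).
    by apply: filter_forall => i; exact: lM.
  apply: filterS => y h My; split.
    by move=> [k /= kN Bk]; exists k => //; apply/(h (Ordinal kN) My).
  by move=> [k /= kN Bk]; exists k => //; apply/(h (Ordinal kN) My).
exists (M `\` D N); split.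
- move=> x clx.
  have Mx : M x by apply: cM => V /clx[z [[Mz _] Vz]]; exists z.
  split => // -[[k _ Bk] nUx].
  have /clx[z [[Mz nDz] [hB hU]]] :
      nbhs x [set y | (M y -> (B_ k y <-> B_ k x)) /\ (M y -> (U N y <-> U N x))].
    by apply: filterI; [exact: lM|exact: lU].
  apply: nDz; split; first by exists k => //; apply/hB.
  by move=> /(hU Mz).
- rewrite setDE setCI setCK.
  apply: le_trans (measureU2 _ _ _) _ => //.
    by apply: measurableC; exact: closed_measurable_borel.
  by rewrite [tau]splitr EFinD leeD.
- move=> x [Mx nDx].
  have := lU x Mx; apply: filterS => y h [My nDy].
  have e z : ~ D N z -> (\bigcup_n B_ n) z <-> U N z.
    move=> nDz; split; first by move=> Bz; apply: contrapT => nUz; exact: nDz.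
    by move=> [k _ Bk]; exists k.
  by rewrite (e _ nDx) (e _ nDy); exact: h.
Qed.

End Regularity.

Definition continuous_along {R : realType} {X : pmetricType R} (M : set X)
    (f : X -> R) : Prop :=
  forall x, M x -> forall eta : R, 0 < eta ->
  \forall y \near x, M y -> `|f x - f y| < eta.

(** Lusin's theorem: make the sets [{f < q}], for [q] rational, relatively clopen. *)
Lemma nearly_continuous {R : realType} {X : pmetricType R}
    (mu : probability (borel X) R) (f : borel X -> R) :
  measurable_fun setT f -> nearly mu (fun M => continuous_along M f).
Proof.
move=> mf tau tau0.
have mB (q : rat) : measurable [set x | f x < ratr q].
  rewrite -[X in measurable X]setTI.
  have -> : [set x | f x < ratr q] = f @^-1` `]-oo, (ratr q)[%classic.
    by apply/seteqP; split => x; rewrite /= in_itv.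
  by apply: mf => //; exact: measurable_itv.
have [||M [cM muM lM]] := @nearly_all _ _ mu rat
  (fun q M => locally_constant_on M [set x | f x < ratr q]) _ _ _ tau0.
- by move=> q M M'; exact: locally_constant_onS.
- by move=> q; exact: nearly_locally_constant.
exists M; split => // x Mx eta eta0.
have [q1] : exists q : rat, ratr q \in `](f x - eta), (f x)[.
  by apply: rat_in_itvoo; rewrite ltrBlDr ltrDl.
rewrite in_itv /= => /andP[q1l q1r].
have [q2] : exists q : rat, ratr q \in `](f x), (f x + eta)[.
  by apply: rat_in_itvoo; rewrite ltrDl.
rewrite in_itv /= => /andP[q2l q2r].
apply: filterS2 (lM q1 x Mx) (lM q2 x Mx) => y h1 h2 My.
have [h1' _] := h1 My; have [_ h2'] := h2 My.
have fy2 := h2' q2l.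
have fy1 : ratr q1 <= f y.
  by rewrite leNgt; apply/negP => /h1' /=; rewrite ltNge (ltW q1r).
rewrite ltr_distl; apply/andP; split.
  by rewrite ltrBlDr; exact: lt_trans fy2 q2r.
by rewrite -ltrBlDr; exact: lt_le_trans q1l fy1.
Qed.

Lemma continuous_along_unif {R : realType} {X : pmetricType R} (M : set X)
    (f : X -> R) (eta : R) :
  compact M -> continuous_along M f -> 0 < eta ->
  exists2 delta : R, 0 < delta &
    forall x y, M x -> M y -> mdist x y < delta -> `|f x - f y| < eta.
Proof.
move=> /compact_near_coveringP cM fM eta0.
have eta20 : 0 < eta / 2 by rewrite divr_gt0.
pose P (d : R) (x : X) := M x -> forall y, M y -> mdist x y < d -> `|f x - f y| < eta.
have : \forall d \near 0^'+, M `<=` P d.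
  apply: cM => x Mx.
  have /nbhs_ballP[r /= r0 xr] := fM x Mx _ eta20.
  exists (ball x (r / 2), [set d | 0 < d < r / 2]) => /=.
    split; first by apply: nbhsx_ballx; rewrite divr_gt0.
    near=> d; apply/andP; split; near: d; first exact: nbhs_right_gt.
    by apply: nbhs_right_lt; rewrite divr_gt0.
  move=> [x' d] [/= xx' /andP[_ dr]] Mx' y My x'y.
  have xx'r : ball x r x' by apply: le_ball xx'; rewrite ler_pdivrMr// ler_peMr ?ler1n// ltW.
  have xyr : ball x r y.
    rewrite (splitr r); apply: ball_triangle xx' _.
    by rewrite ballEmdist /=; exact: lt_trans dr.
  rewrite (splitr eta) -(subrK (f x) (f x')) -addrA.
  apply: le_lt_trans (ler_normD _ _) _; apply: ltrD; last exact: xr.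
  by rewrite distrC; exact: xr.
move=> nd.
have [d [d0 Pd]] : exists d, 0 < d /\ M `<=` P d.
  have : \forall d \near 0^'+, 0 < d /\ M `<=` P d.
    by apply: filterI => //; exact: nbhs_right_gt.
  by move=> /filter_ex.
by exists d => // x y Mx My; exact: (Pd x Mx Mx y My).
Unshelve. all: end_near. Qed.

(** * Visits to a set and the maximal ergodic inequality *)

Definition visits {Y : Type} (T : Y -> Y) (B : set Y) (n : nat) (x : Y) : nat :=
  \sum_(i < n) (iter i T x \in B).

Section Visits.
Context {Y : Type} (T : Y -> Y) (B : set Y).

Lemma visits0 x : visits T B 0 x = 0%N.
Proof. by rewrite /visits big_ord0. Qed.

Lemma visitsS n x : visits T B n.+1 x = (visits T B n x + (iter n T x \in B))%N.
Proof. by rewrite /visits big_ord_recr. Qed.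

Lemma visitsD m n x :
  visits T B (m + n) x = (visits T B m x + visits T B n (iter m T x))%N.
Proof.
by rewrite /visits big_split_ord /=; congr addn; apply: eq_bigr => i _; rewrite addnC iterD.
Qed.

Lemma leq_visits m n x : (m <= n)%N -> (visits T B m x <= visits T B n x)%N.
Proof. by move=> /subnKC <-; rewrite visitsD leq_addr. Qed.

Lemma visits_le n x : (visits T B n x <= n)%N.
Proof.
elim: n => [|n IH]; first by rewrite visits0.
by rewrite visitsS -addn1 leq_add// leq_b1.
Qed.

End Visits.

Definition frequent {R : realType} {Y : Type} (T : Y -> Y) (B : set Y) (k : R) (N : nat) :
    set Y :=
  [set x | exists n, [/\ (0 < n)%N, (n <= N)%N & k * n%:R < (visits T B n x)%:R]].

(** Walk along the orbit: at a point of [frequent T B k N], jump over an interval of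
    length at most [N] in which the proportion of visits to [B] exceeds [k];
    elsewhere, move one step.  All the visits to [frequent T B k N] before time [L]
    lie in the intervals jumped over, and these end before time [L + N]. *)
Lemma frequent_covering {R : realType} {Y : Type} (T : Y -> Y) (B : set Y) (k : R)
    (N L : nat) (x : Y) : 0 <= k ->
  k * (visits T (frequent T B k N) L x)%:R <= (visits T B (L + N) x)%:R.
Proof.
move=> k0; elim/ltn_ind: L x => L IH x.
case: L IH => [|L] IH; first by rewrite visits0 mulr0 ler0n.
have [xZ|xZ] := boolP (x \in frequent T B k N); last first.
  have -> : visits T (frequent T B k N) L.+1 x = visits T (frequent T B k N) L (T x).
    by rewrite -add1n visitsD visitsS visits0 (negbTE xZ).
  apply: le_trans (IH L _ (T x)) _ => //.
  by rewrite ler_nat addSn -add1n (visitsD T B 1) leq_addl.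
move: (xZ) => /set_mem[n [n0 nN kn]].
have [Ln|nL] := leqP L.+1 n.
  apply: (@le_trans _ _ (k * n%:R)).
    by rewrite ler_wpM2l// ler_nat (leq_trans (visits_le _ _ _ _)).
  apply: le_trans (ltW kn) _; rewrite ler_nat leq_visits//.
  by rewrite (leq_trans nN)// leq_addl.
rewrite -(subnKC (ltnW nL)) -addnA !(visitsD _ _ n) !natrD mulrDr lerD//.
  by apply: le_trans (ltW kn); rewrite ler_wpM2l// ler_nat visits_le.
by apply: IH; rewrite ltn_subrL n0.
Qed.

Section MeasurePreserving.
Context {R : realType} {d : measure_display} {Y : measurableType d}.
Variables (mu : probability Y R) (T : Y -> Y).
Hypothesis mT : measurable_fun setT T.
Hypothesis Tmu : forall B : set Y, measurable B -> mu (T @^-1` B) = mu B.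

Lemma measurable_iter n : measurable_fun setT (iter n T).
Proof.
by elim: n => [|n IH] /=; [exact: measurable_id|exact: measurableT_comp].
Qed.

Lemma measurable_iter_preimage n (B : set Y) :
  measurable B -> measurable (iter n T @^-1` B).
Proof. by move=> mB; rewrite -[X in measurable X]setTI; exact: measurable_iter. Qed.

Lemma measure_iter_preimage n (B : set Y) :
  measurable B -> mu (iter n T @^-1` B) = mu B.
Proof.
elim: n => [//|n IH] mB.
have -> : iter n.+1 T @^-1` B = T @^-1` (iter n T @^-1` B).
  by apply/seteqP; split => x /=; rewrite -iterSr.
by rewrite Tmu ?IH//; exact: measurable_iter_preimage.
Qed.

Lemma visits_indic (B : set Y) n x :
  (visits T B n x)%:R = \sum_(i < n) \1_(iter i T @^-1` B) x :> R.
Proof. by rewrite /visits natr_sum. Qed.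

Lemma measurable_visits (B : set Y) n : measurable B ->
  measurable_fun setT (fun x => (visits T B n x)%:R : R).
Proof.
move=> mB; under eq_fun do rewrite visits_indic.
apply: measurable_sum => i.
by apply: measurable_indic; exact: measurable_iter_preimage.
Qed.

Lemma integral_visits (B : set Y) n : measurable B ->
  (\int[mu]_x ((visits T B n x)%:R : R)%:E = n%:R%:E * mu B)%E.
Proof.
move=> mB; under eq_integral do rewrite visits_indic -sumEFin.
rewrite ge0_integral_sum//; last first.
  move=> i; apply/measurable_EFinP/measurable_indic; exact: measurable_iter_preimage.
have E i : (\int[mu]_x (\1_(iter i T @^-1` B) x)%:E = mu B)%E.
  rewrite integral_indic//; last exact: measurable_iter_preimage.
  by rewrite setIT; exact: measure_iter_preimage.
under eq_bigr do rewrite E.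
rewrite -(fineK (fin_num_measure mu _ mB)) sumEFin -EFinM sumr_const card_ord.
by rewrite mulr_natl.
Qed.

Lemma measurable_frequent (B : set Y) (k : R) N :
  measurable B -> measurable (frequent T B k N).
Proof.
move=> mB.
have -> : frequent T B k N =
    \bigcup_(n in [set n | (0 < n)%N /\ (n <= N)%N]) [set x | k * n%:R < (visits T B n x)%:R].
  apply/seteqP; split => x; first by move=> [n [n0 nN xn]]; exists n.
  by move=> [n [n0 nN] xn]; exists n.
apply: bigcup_measurable => n _; rewrite -[X in measurable X]setTI.
have -> : [set x | k * n%:R < (visits T B n x)%:R] =
    (fun x => (visits T B n x)%:R : R) @^-1` `]k * n%:R, +oo[%classic.
  by apply/seteqP; split => x; rewrite /= in_itv /= andbT.
by apply: measurable_visits => //; exact: measurable_itv.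
Qed.

(** Integrating [frequent_covering] gives
    [k * L * mu (frequent T B k N) <= (L + N) * mu B]; divide by [L] and let [L]
    tend to infinity. *)
Lemma measure_frequent (B : set Y) (k : R) N : measurable B -> 0 < k ->
  (k%:E * mu (frequent T B k N) <= mu B)%E.
Proof.
move=> mB k0; have mZ := measurable_frequent k N mB.
rewrite -(fineK (fin_num_measure mu _ mB)) -(fineK (fin_num_measure mu _ mZ)).
set b := fine (mu B); set z := fine (mu _).
rewrite -EFinM lee_fin.
have b0 : 0 <= b by exact: fine_ge0.
have key (L : nat) : k * (L%:R * z) <= L%:R * b + N%:R * b.
  rewrite -mulrDl -lee_fin -natrD 3!EFinM /b /z !fineK ?fin_num_measure//.
  rewrite -!integral_visits// -ge0_integralZl//; last 2 first.
  - by apply/measurable_EFinP; exact: measurable_visits.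
  - by rewrite lee_fin ltW.
  apply: ge0_le_integral => //.
  - by move=> x _; rewrite -EFinM lee_fin mulr_ge0// ltW.
  - by apply/measurable_EFinP; apply: measurable_funM => //; exact: measurable_visits.
  - by apply/measurable_EFinP; exact: measurable_visits.
  - by move=> x _; rewrite -EFinM lee_fin; apply: frequent_covering; exact: ltW.
rewrite leNgt; apply/negP => bkz.
have kzb : 0 < k * z - b by rewrite subr_gt0.
have := archi_boundP (divr_ge0 (mulr_ge0 (ler0n R N) b0) (ltW kzb)).
set L := Num.bound _; rewrite ltr_pdivrMr// mulrBr ltrBrDr ltNge addrC => /negP; apply.
by apply: le_trans (key L); rewrite mulrCA.
Qed.

End MeasurePreserving.

Section Maximal.
Context {R : realType} {d : measure_display} {Y : measurableType d}.
Variables (mu : probability Y R) (T : Y -> Y).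
Hypothesis mT : measurable_fun setT T.
Hypothesis Tmu : forall B : set Y, measurable B -> mu (T @^-1` B) = mu B.

Lemma maximal_ergodic_inequality (B : set Y) (k : R) : measurable B -> 0 < k ->
  measurable (\bigcup_N frequent T B k N) /\
  (mu (\bigcup_N frequent T B k N) <= k^-1%:E * mu B)%E.
Proof.
move=> mB k0.
have mZ N : measurable (frequent T B k N) by exact: measurable_frequent.
have mU : measurable (\bigcup_N frequent T B k N) by exact: bigcup_measurable.
split=> //.
have nd : {homo frequent T B k : n m / (n <= m)%N >-> (n <= m)%O}.
  move=> n m nm; apply/subsetPset => x [i [i0 iN xi]]; exists i.
  by split => //; exact: leq_trans nm.
have cv := @nondecreasing_cvg_mu _ _ _ mu _ mZ mU nd.
rewrite -(cvg_lim (@ereal_hausdorff R) cv).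
apply: lime_le; first by apply/cvg_ex; exists (mu (\bigcup_N frequent T B k N)).
apply: nearW => N /=.
by rewrite lee_pdivlMl//; exact: measure_frequent.
Qed.

(** An orbit visits [B] at most once, so that [n * mu B <= 1] for all [n]. *)
Lemma wandering_null (B : set Y) : measurable B ->
  (forall x n, B x -> (0 < n)%N -> ~ B (iter n T x)) -> mu B = 0%E.
Proof.
move=> mB wB.
have v1 n x : (visits T B n x <= 1)%N.
  elim: n x => [|n IH] x; first by rewrite visits0.
  rewrite -add1n visitsD visitsS visits0 /=.
  have [/set_mem Bx|_] := boolP (x \in B); last exact: IH.
  rewrite /visits big1 ?addn0// => i _.
  by rewrite -iterSr; apply/eqP; rewrite eqb0; apply/negP => /set_mem; exact: wB.
have b0 : 0 <= fine (mu B) by exact: fine_ge0.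
rewrite -(fineK (fin_num_measure mu _ mB)); congr EFin.
apply/eqP; rewrite eq_le b0 andbT leNgt; apply/negP => bgt0.
have := archi_boundP (ltW (divr_gt0 ltr01 bgt0)).
set n := Num.bound _; rewrite ltr_pdivrMr// ltNge => /negP; apply.
rewrite -lee_fin EFinM fineK ?fin_num_measure// -(integral_visits mT Tmu)//.
apply: (@le_trans _ _ (\int[mu]_x (cst 1%:E x))%E).
  apply: ge0_le_integral => //.
  - by apply/measurable_EFinP; exact: measurable_visits.
  - by move=> x _; rewrite lee_fin (ler_nat R _ 1).
by rewrite integral_cst// mul1e; exact: probability_le1.
Qed.

Lemma orbitwise_null (N : set Y) : measurable N -> mu N = 0%E ->
  measurable (\bigcup_t (iter t T @^-1` N)) /\
  mu (\bigcup_t (iter t T @^-1` N)) = 0%E.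
Proof.
move=> mN N0.
have mU : measurable (\bigcup_t (iter t T @^-1` N)).
  by apply: bigcup_measurable => t _; exact: measurable_iter_preimage.
split => //; apply/negligibleP => //; apply: negligible_bigcup => t.
exists (iter t T @^-1` N); split => //; first exact: measurable_iter_preimage.
exact: etrans (measure_iter_preimage mT Tmu t mN) N0.
Qed.

End Maximal.

(** * Iterates of the induced map *)

Section ReturnTime.
Context {R : realType} {X : pmetricType R}.
Variables (T : X -> X) (A : set X).

Lemma return_timeP x t : (0 < t)%N -> A (iter t T x) ->
  [/\ (0 < return_time T A x)%N, A (iter (return_time T A x) T x) &
    forall m, (0 < m)%N -> A (iter m T x) -> (return_time T A x <= m)%N].
Proof.
move=> t0 At; rewrite /return_time.
have ex : exists n, (0 < n)%N && `[< A (iter n T x) >].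
  by exists t; rewrite t0; exact/asboolP.
case: (ex_minnP ex) => n /andP[n0 /asboolP An] nmin.
set P := [set _ | _]; suff : P (xget 0%N P) by [].
apply: (@xgetPex _ 0%N P); exists n; split => // m m0 Am; apply: nmin.
by rewrite m0; exact/asboolP.
Qed.

Lemma visits_return_time x : A x -> (0 < return_time T A x)%N ->
  (forall m, (0 < m)%N -> A (iter m T x) -> (return_time T A x <= m)%N) ->
  visits T A (return_time T A x) x = 1%N.
Proof.
move: (return_time T A x) => r Ax r0 rmin.
rewrite -(prednK r0) -add1n visitsD visitsS visits0 /= mem_set// /visits big1 ?addn0// => i _.
rewrite -iterSr; apply/eqP; rewrite eqb0; apply/negP => /set_mem /(rmin _ (ltn0Sn _)).
by rewrite leqNgt -ltn_predRL ltn_ord.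
Qed.

(** At a time [t] when the orbit is in [A], the point [iter t T x] is the image of
    [x] by as many iterations of the induced map as there are visits to [A] in
    [0 .. t-1]. *)
Lemma eigen_visits {C : comRingType} (e : X -> C) (l : C) x t :
  (forall s, A (iter s T x) ->
     e (induced_map T A (iter s T x)) = l * e (iter s T x)) ->
  A x -> A (iter t T x) -> e (iter t T x) = l ^+ visits T A t x * e x.
Proof.
elim/ltn_ind: t x => t IH x ex Ax At.
have [->|t0] := posnP t; first by rewrite visits0 expr0 mul1r.
have [r0 Ar rmin] := return_timeP t0 At.
have v1 := visits_return_time Ax r0 rmin.
have rt := rmin t t0 At; have e1 := ex 0%N Ax.
rewrite /= /induced_map in e1.
move: (return_time T A x) r0 Ar rmin v1 rt e1 => r r0 Ar _ v1 rt e1.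
rewrite -(subnK rt) iterD addnC visitsD v1 (IH (t - r)%N); last 1 first.
- by rewrite -iterD subnK.
- by rewrite e1 exprD expr1 mulrA (mulrC (l ^+ _)).
- by rewrite ltn_subrL r0.
- by move=> s; rewrite -iterD; exact: ex.
- exact: Ar.
Qed.

End ReturnTime.

(** * Complex-valued measurable functions *)

Section ComplexNorm.
Context {R : realType}.
Implicit Types z w : R[i].

Lemma normcE z : normc z = Num.sqrt (complex.Re z ^+ 2 + complex.Im z ^+ 2).
Proof. by case: z. Qed.

Lemma normc_ge0 z : 0 <= normc z.
Proof. by rewrite normcE sqrtr_ge0. Qed.

Lemma normcX z n : normc (z ^+ n) = normc z ^+ n.
Proof. by elim: n => [|n IH]; rewrite ?expr0 ?Normc.normc1// !exprS Normc.normcM IH. Qed.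

Lemma ler_normcD z w : normc (z + w) <= normc z + normc w.
Proof. exact: le_normcD. Qed.

Lemma ler_normc_sum (I : Type) (r : seq I) (F : I -> R[i]) :
  normc (\sum_(i <- r) F i) <= \sum_(i <- r) normc (F i).
Proof.
elim: r => [|i r IH]; first by rewrite !big_nil Normc.normc0.
by rewrite !big_cons (le_trans (ler_normcD _ _))// lerD2l.
Qed.

Lemma normc_real (a : R) : normc a%:C%C = `|a|.
Proof. by rewrite normcE /= expr0n addr0 sqrtr_sqr. Qed.

Lemma ler_normc_ReIm z : normc z <= `|complex.Re z| + `|complex.Im z|.
Proof.
rewrite normcE -(ger0_norm (addr_ge0 (normr_ge0 (complex.Re z)) (normr_ge0 (complex.Im z)))).
rewrite -sqrtr_sqr; apply: ler_wsqrtr; rewrite sqrrD !real_normK ?num_real//.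
by rewrite addrAC lerDl mulrn_wge0// mulr_ge0.
Qed.

End ComplexNorm.

Definition measurable_complex {R : realType} {d} {Y : measurableType d}
    (f : Y -> R[i]) : Prop :=
  measurable_fun setT (fun x => complex.Re (f x)) /\
  measurable_fun setT (fun x => complex.Im (f x)).

Section MeasurableComplex.
Context {R : realType} {d : measure_display} {Y : measurableType d}.
Implicit Types f g : Y -> R[i].

Lemma measurable_normc f : measurable_complex f ->
  measurable_fun setT (fun x => normc (f x)).
Proof.
move=> [mr mi]; under eq_fun do rewrite normcE.
apply: (@measurableT_comp _ _ _ _ _ _ (@Num.sqrt R)).
  by apply: continuous_measurable_fun; exact: sqrt_continuous.
by apply: measurable_funD; exact: measurable_funX.
Qed.

Lemma measurable_complexB f g : measurable_complex f -> measurable_complex g ->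
  measurable_complex (fun x => f x - g x).
Proof.
move=> [fr fi] [gr gi]; split.
  by under eq_fun do rewrite (raddfB (@complex.Re R)); exact: measurable_funB.
by under eq_fun do rewrite (raddfB (@complex.Im R)); exact: measurable_funB.
Qed.

Lemma measurable_complexZ (c : R[i]) f : measurable_complex f ->
  measurable_complex (fun x => c * f x).
Proof.
move=> [fr fi]; case: c => a b; split.
  have -> : (fun x => complex.Re ((a +i* b)%C * f x)) =
    (fun x => a * complex.Re (f x) - b * complex.Im (f x)).
    by apply/funext => x; case: (f x).
  by apply: measurable_funB; apply: measurable_funM.
have -> : (fun x => complex.Im ((a +i* b)%C * f x)) =
    (fun x => a * complex.Im (f x) + b * complex.Re (f x)).
  by apply/funext => x; case: (f x).
by apply: measurable_funD; apply: measurable_funM.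
Qed.

Lemma measurable_complex_sum (I : Type) (r : seq I) (F : I -> Y -> R[i]) :
  (forall i, measurable_complex (F i)) ->
  measurable_complex (fun x => \sum_(i <- r) F i x).
Proof.
move=> mF; split.
  under eq_fun do rewrite (raddf_sum (@complex.Re R)).
  by apply: measurable_sum => i; have [] := mF i.
under eq_fun do rewrite (raddf_sum (@complex.Im R)).
by apply: measurable_sum => i; have [] := mF i.
Qed.

Lemma L2_chebyshev (nu : probability Y R) f (a b : R) :
  measurable_complex f -> 0 < a -> 0 <= b -> (L2norm nu f < b%:E)%E ->
  measurable [set x | a <= normc (f x)] /\
  (nu [set x | (a <= normc (f x))%R] <= (b ^+ 2 / a ^+ 2)%:E)%E.
Proof.
move=> mf a0 b0 fb; have mn := measurable_normc mf.
have mS : measurable [set x | a <= normc (f x)].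
  rewrite -[X in measurable X]setTI.
  have -> : [set x | a <= normc (f x)] = (fun x => normc (f x)) @^-1` `[a, +oo[%classic.
    by apply/seteqP; split => x; rewrite /= in_itv /= andbT.
  by apply: mn => //; exact: measurable_itv.
split => //.
have h := @le_integral_comp_abse _ _ _ nu setT measurableT
  (fun x => (normc (f x))%:E) a (fun r : \bar R => (r `^ 2)%E).
have {h} := h (@measurable_poweR R 2) _ _ _ a0.
rewrite -(@poweR_Lnorm _ _ _ nu (fun x => (normc (f x))%:E) 2) ?pnatr_eq0// -/(L2norm nu f).
move=> /(_ _ _ _)/wrap[||| h].
- by move=> r _; exact: poweR_ge0.
- move=> x y; rewrite !inE/= !in_itv/= !andbT => x0 y0 xy.
  by apply: gt0_ler_poweR => //; rewrite in_itv /= ?x0 ?y0 leey.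
- exact/measurable_EFinP.
have {h} : ((a ^+ 2)%:E * nu [set x | a <= normc (f x)]%R <= (b ^+ 2)%:E)%E.
  rewrite -[b ^+ 2]powR_mulrn// -[a ^+ 2](powR_mulrn _ (ltW a0)) -!poweR_EFin.
  have -> : [set x | a <= normc (f x)] = setT `&` [set x | (a%:E <= `|(normc (f x))%:E|)%E].
    by rewrite setTI; apply/seteqP; split => x; rewrite /= lee_fin ger0_norm ?normc_ge0.
  apply: le_trans h _; apply: gt0_ler_poweR => //.
  - by rewrite in_itv /= Lnorm_ge0 leey.
  - by rewrite in_itv /= lee_fin b0 leey.
  - exact: ltW.
by rewrite -lee_pdivlMl ?exprn_gt0// -EFinM mulrC.
Qed.

End MeasurableComplex.

(** * Eigenvalues of the induced map *)

Section Eigenvalue.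
Context {R : realType} {X : pmetricType R}.
Variables (mu : probability (borel X) R) (T : borel X -> borel X).
Hypothesis mT : measurable_fun setT T.
Hypothesis Tmu : forall B : set (borel X), measurable B -> mu (T @^-1` B) = mu B.

(** If [q] separates [|e x|] from [|l| |e x|], then it separates [|e x|] from the
    value of [|e|] at every later visit of [x] to [A]: the set of such [x] is
    wandering. *)
Lemma eigenvalue_le1 (A N : set (borel X)) (e : borel X -> R[i]) (l : R[i]) :
  measurable A -> measurable N -> mu N = 0%E -> measurable_complex e ->
  (forall x, A x -> ~ N x -> e (induced_map T A x) = l * e x) ->
  1 < normc l -> mu.-negligible (A `&` [set x | e x <> 0]).
Proof.
move=> mA mN N0 me eN l1.
have [mO O0] := orbitwise_null mT Tmu mN N0.
set O := \bigcup_t _ in mO O0.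
pose q (k : nat) : R := ratr (odflt 0%R (unpickle k)).
pose B k := (A `\` O) `&` [set x | normc (e x) < q k /\ q k < normc l * normc (e x)].
have mB k : measurable (B k).
  apply: measurableI; first exact: measurableD.
  have mn := measurable_normc me.
  have -> : [set x | normc (e x) < q k /\ q k < normc l * normc (e x)] =
    (setT `&` (fun x => normc (e x)) @^-1` `]-oo, q k[%classic) `&`
    (setT `&` (fun x => normc l * normc (e x)) @^-1` `]q k, +oo[%classic).
    by rewrite !setTI; apply/seteqP; split => x; rewrite /= !in_itv /= andbT.
  by apply: measurableI; [apply: mn|apply: measurable_funM] => //; exact: measurable_itv.
have wB k : mu (B k) = 0%E.
  apply: (wandering_null mT Tmu) => // x n [[Ax nOx] [_ xq]] n0 [[An _] [nq _]].
  have ex s : A (iter s T x) ->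
      e (induced_map T A (iter s T x)) = l * e (iter s T x).
    by move=> As; apply: eN => // Ns; apply: nOx; exists s.
  move: nq; rewrite (eigen_visits ex Ax An) Normc.normcM normcX ltNge => /negP; apply.
  apply: (le_trans (ltW xq)); rewrite ler_wpM2r ?normc_ge0//.
  have v1 : (1 <= visits T A n x)%N.
    apply: leq_trans (leq_visits T A x n0).
    by rewrite visitsS visits0 /= mem_set.
  by rewrite -(prednK v1) exprS ler_peMr ?normc_ge0// exprn_ege1// ltW.
have : mu.-negligible (O `|` \bigcup_k B k).
  apply: negligibleU; first by exists O; split.
  by apply: negligible_bigcup => k; exists (B k); split; [exact: mB|exact: wB|].
apply: negligibleS => x [Ax ex0]; have [Ox|nOx] := pselect (O x); [by left|right].
have e0 : 0 < normc (e x).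
  rewrite lt_neqAle normc_ge0 andbT eq_sym; apply/eqP => /Normc.eq0_normc; exact: ex0.
have [r] : exists r : rat, ratr r \in `](normc (e x)), (normc l * normc (e x))[.
  by apply: rat_in_itvoo; rewrite ltr_pMl.
rewrite in_itv /= => /andP[r1 r2].
by exists (pickle r) => //; split => //; rewrite /q /= pickleK.
Qed.

End Eigenvalue.

Section InducedMeasure.
Context {R : realType} {X : pmetricType R}.
Variables (mu : probability (borel X) R) (A : set (borel X)) (mA : measurable A).
Hypothesis A0 : (0 < mu A)%E.

Lemma induced_measureE (U : set (borel X)) :
  induced_measure mu mA U = (mu (U `&` A) * (fine (mu A))^-1%:E)%E.
Proof.
have fA : mu A \is a fin_num by exact: fin_num_measure.
rewrite /induced_measure /= /mnormalize /= /mrestr setTI.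
by rewrite gt_eqF//= lt_eqF ?ltey_eq ?fA.
Qed.

Lemma le_induced_measure (U : set (borel X)) :
  (mu (U `&` A) <= induced_measure mu mA U)%E.
Proof.
have fA : mu A \is a fin_num by exact: fin_num_measure.
rewrite induced_measureE lee_pemulr// lee_fin invf_ge1 -?lee_fin -?lte_fin fineK//.
exact: probability_le1.
Qed.

Lemma induced_negligible (N : set (borel X)) :
  (induced_measure mu mA).-negligible N ->
  exists N' : set (borel X), [/\ measurable N', mu N' = 0%E & N `&` A `<=` N'].
Proof.
move=> [N' [mN' N'0 NN']]; exists (N' `&` A); split.
- exact: measurableI.
- by apply/eqP; rewrite eq_le measure_ge0 andbT -N'0; exact: le_induced_measure.
- by move=> x [/NN' ? ?].
Qed.

Lemma negligible_induced (N : set (borel X)) :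
  mu.-negligible (A `&` N) -> (induced_measure mu mA).-negligible N.
Proof.
move=> [N' [mN' N'0 NN']]; exists (N' `|` ~` A); split.
- by apply: measurableU => //; exact: measurableC.
- apply: etrans (induced_measureE _) _; rewrite setIUl (setIC (~` A)) setICr setU0.
  suff -> : mu (N' `&` A) = 0%E by rewrite mul0e.
  apply/eqP; rewrite eq_le measure_ge0 andbT -N'0.
  by apply: le_measure; rewrite ?inE//; exact: measurableI.
- by move=> x Nx; have [Ax|] := pselect (A x); [left; apply: NN'|right].
Qed.

End InducedMeasure.

(** * Matching the visits of two orbits *)

Section Matching.
Context {R : realType} {X : pmetricType R}.
Variables (T : X -> X) (A G : set X).

Lemma visitsC n x : (visits T G n x + visits T (~` G) n x)%N = n.
Proof.
rewrite /visits -big_split /= -[RHS]card_ord -sum1_card; apply: eq_bigr => i _.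
by rewrite in_setC; case: (_ \in G).
Qed.

Lemma visits_ltn t t' x : A (iter t T x) -> (t < t')%N ->
  (visits T A t x < visits T A t' x)%N.
Proof.
move=> At /(leq_visits T A x); apply: leq_trans.
by rewrite visitsS mem_set// addn1.
Qed.

(** [visits T A t z] is the rank of [t] among the times of visit of [z] to [A].  The
    match [p] preserves ranks; its domain [D] is made of the visits of [x] to [G]
    whose rank is also that of a visit of [y] to [G].  As ranks determine visits and
    are less than [n], inclusion-exclusion on the two sets of ranks bounds the size
    of [D] from below. *)
Lemma visits_max_match n (delta : R) x y : G `<=` A ->
  (forall t s, G (iter t T x) -> G (iter s T y) ->
     visits T A t x = visits T A s y -> mdist (iter t T x) (iter s T y) < delta) ->
  (visits T G n x + visits T G n y <= n + max_match T n delta x y)%N.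
Proof.
move=> GA close.
have rk_lt z (t : 'I_n) : (visits T A t z < n)%N.
  by apply: leq_ltn_trans (visits_le _ _ _ _) (ltn_ord t).
pose rk z (t : 'I_n) := Ordinal (rk_lt z t).
pose S z := [set t : 'I_n | iter t T z \in G]%SET.
have rk_inj z : {in S z &, injective (rk z)}.
  move=> t t'; rewrite !finset.in_set => /set_mem/GA At /set_mem/GA At' /(congr1 val) /= E.
  apply: val_inj => /=; case: (ltngtP t t') => // /visits_ltn lt.
    by have := lt _ At; rewrite E ltnn.
  by have := lt _ At'; rewrite E ltnn.
have cardS z : #|rk z @: S z| = visits T G n z.
  rewrite card_in_imset; last exact: rk_inj.
  by rewrite /visits -sum1_card big_mkcond; apply: eq_bigr => t _; rewrite finset.in_set.
pose D := [set t in S x | rk x t \in rk y @: S y]%SET.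
pose p := [ffun t : 'I_n => odflt t [pick s in S y | rk y s == rk x t]].
have pP t : t \in D -> p t \in S y /\ rk y (p t) = rk x t.
  rewrite !finset.in_set => /andP[_ /imsetP[s sS E]]; rewrite ffunE.
  case: pickP => /= [s'|/(_ s)].
    by rewrite !finset.in_set => /andP[? /eqP].
  by rewrite sS E eqxx.
have mD : is_match T delta x y D p.
  apply/andP; split; apply/forall_inP => t tD; have [ptS ptE] := pP t tD.
    apply/forall_inP => t' t'D; apply/implyP => tt'; have [pt'S pt'E] := pP t' t'D.
    have At : A (iter t T x) by move: tD; rewrite !finset.in_set => /andP[/set_mem/GA].
    rewrite ltnNge; apply/negP => /(leq_visits T A y).
    move: (congr1 val ptE) (congr1 val pt'E) => /= -> ->.
    by rewrite leqNgt => /negP; apply; exact: visits_ltn.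
  apply: close; last by move: (congr1 val ptE) => /= ->.
    by move: tD; rewrite !finset.in_set => /andP[/set_mem].
  by move: ptS; rewrite finset.in_set => /set_mem.
have Dmax : (#|D| <= max_match T n delta x y)%N.
  exact: (@leq_bigmax_cond _ (fun m : {set 'I_n} * {ffun 'I_n -> 'I_n} =>
    is_match T delta x y m.1 m.2) (fun m => #|m.1|) (D, p) mD).
rewrite -!cardS -cardsUI; apply: leq_add.
  by rewrite -[X in (_ <= X)%N]card_ord max_card.
apply: leq_trans Dmax.
have -> : (rk x @: S x :&: rk y @: S y = rk x @: D)%SET.
  apply/setP => r; rewrite finset.in_setI; apply/andP/imsetP.
    by move=> [/imsetP[t tS ->] rS]; exists t => //; rewrite finset.in_set tS.
  by move=> [t]; rewrite finset.in_set => /andP[tS rS] ->; split => //; exact: imset_f.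
exact: leq_imset_card.
Qed.

Lemma max_match_le n (delta : R) x y : (max_match T n delta x y <= n)%N.
Proof. by apply/bigmax_leqP => m _; rewrite -[X in (_ <= X)%N]card_ord max_card. Qed.

Lemma fbar_le (delta k : R) x y :
  (forall n, (n%:R * (1 - k) <= (max_match T n delta x y)%:R)) ->
  fbar T delta x y <= k.
Proof.
move=> hk; rewrite /fbar.
have u01 n : 0 <= fbar_n T n delta x y <= 1.
  rewrite /fbar_n subr_ge0 gerBl divr_ge0 ?ler0n// andbT.
  have [->|n0] := posnP n; first by rewrite invr0 mulr0.
  by rewrite ler_pdivrMr ?ltr0n// mul1r ler_nat max_match_le.
have bu : bounded_fun (fun n => fbar_n T n delta x y).
  exists 1; split => // M M1 n _ /=.
  have /andP[u0 u1] := u01 n.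
  by rewrite ger0_norm// (le_trans u1)// ltW.
rewrite limn_supE//.
(* The term of index 0 is 1, because of the division by 0: start from index 1. *)
apply: (@le_trans _ _ (sups (fun n => fbar_n T n delta x y) 1%N)).
  apply: ge_inf; last by exists 1%N.
  exact: bounded_fun_has_lbound_sups.
apply: ge_sup.
  by exists (fbar_n T 1 delta x y); exists 1%N.
move=> _ [n /= n0 <-]; rewrite /fbar_n lerBlDr -lerBlDl.
by rewrite ler_pdivlMr ?ltr0n// mulrC.
Qed.

Lemma d_FK_le (eps : R) x y : 0 < eps -> fbar T eps x y < eps -> d_FK T x y <= eps.
Proof.
move=> e0 fe; apply: ge_inf; last by split.
by exists 0 => z [/ltW].
Qed.

Lemma d_FK_le_visits (eps k : R) x y : G `<=` A -> 0 < eps -> 2 * k < eps ->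
  (forall n, (visits T (~` G) n x)%:R <= k * n%:R) ->
  (forall n, (visits T (~` G) n y)%:R <= k * n%:R) ->
  (forall t s, G (iter t T x) -> G (iter s T y) ->
     visits T A t x = visits T A s y -> mdist (iter t T x) (iter s T y) < eps) ->
  d_FK T x y <= eps.
Proof.
move=> GA e0 ke bx by_ close; apply: d_FK_le => //.
apply: le_lt_trans ke; apply: fbar_le => n.
have := visits_max_match n GA close; rewrite -(ler_nat R) !natrD.
have := congr1 (fun m => m%:R : R) (visitsC n x).
have := congr1 (fun m => m%:R : R) (visitsC n y).
rewrite !natrD; have := bx n; have := by_ n.
move: (visits T (~` G) n x)%:R (visits T (~` G) n y)%:R => a b.
move: (visits T G n x)%:R (visits T G n y)%:R (max_match _ _ _ _ _)%:R n%:R => c d m n'.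
by lra.
Qed.

End Matching.

(** * A bounded function that separates distant points *)

Section Code.
Context {R : realType} {X : pmetricType R}.

(** The index of the first ball that contains [z], with centre in [s]: a recursion
    whose steps are visibly measurable.  Taking interiors makes each of these
    sets a Borel set. *)
Fixpoint ball_code (r : R) (s : seq X) (z : X) : R :=
  if s is c :: s' then \1_(~` (ball c r)^°) z * (1 + ball_code r s' z) else 0.

Lemma ball_code_ge0 r s z : 0 <= ball_code r s z.
Proof. by elim: s => [//|c s IH] /=; rewrite mulr_ge0// addr_ge0. Qed.

Lemma ball_code_le r s z : ball_code r s z <= (size s)%:R.
Proof.
elim: s => [//|c s IH] /=; rewrite -natr1 addrC.
have h : 0 <= ball_code r s z + 1 by rewrite addr_ge0// ball_code_ge0.
by rewrite indicE; case: (_ \in _); rewrite ?mul1r ?mul0r ?lerD2r// addr_ge0.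
Qed.

Lemma measurable_ball_code r s :
  measurable_fun setT (ball_code r s : borel X -> R).
Proof.
elim: s => [|c s IH] /=; first exact: measurable_cst.
apply: measurable_funM; last exact: measurable_funD.
apply: measurable_indic; apply: measurableC; apply: open_measurable_borel.
exact: open_interior.
Qed.

Lemma ball_code_eq r s z z' :
  (exists2 c, c \in s & (ball c r)^° z) -> (exists2 c, c \in s & (ball c r)^° z') ->
  `|ball_code r s z - ball_code r s z'| < 1 ->
  exists c, ball c r z /\ ball c r z'.
Proof.
elim: s => [|c s IH] /= [a] ; first by rewrite in_nil.
move=> as_ az [b bs bz].
have ge1 u : 1 <= 1 + ball_code r s u by rewrite lerDl ball_code_ge0.
rewrite !indicE !in_setC.
have [cz|ncz] := pselect ((ball c r)^° z); have [cz'|ncz'] := pselect ((ball c r)^° z').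
- by move=> _; exists c; split; exact: interior_subset.
- rewrite mem_set// memNset//= mul0r mul1r sub0r normrN ger0_norm ?(le_trans ler01)//.
  by rewrite ltNge ge1.
- rewrite memNset// mem_set//= mul0r mul1r subr0 ger0_norm ?(le_trans ler01)//.
  by rewrite ltNge ge1.
- rewrite !memNset//= !mul1r opprD addrACA subrr add0r; apply: IH.
    exists a => //; move: as_; rewrite in_cons => /orP[/eqP E|//].
    by rewrite E in az.
  exists b => //; move: bs; rewrite in_cons => /orP[/eqP E|//].
  by rewrite E in bz.
Qed.

Lemma exists_code (eps : R) : compact [set: X] -> 0 < eps ->
  exists (f : borel X -> R) (C : R), [/\ measurable_fun setT f,
    forall z, 0 <= f z <= C &
    forall z z', `|f z - f z'| < 1 -> mdist z z' < eps].
Proof.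
move=> cX e0; have e20 : 0 < eps / 2 by rewrite divr_gt0.
move: cX; rewrite compact_cover => /(_ X setT (fun c => (ball c (eps / 2))^°)).
case=> [c _|z _|D _ Dcov].
- exact: open_interior.
- by exists z => //; apply: nbhs_singleton; apply: nbhs_interior; exact: nbhsx_ballx.
have cov z : exists2 c, c \in finmap.enum_fset D & (ball c (eps / 2))^° z.
  by have [c cD zc] := Dcov z I; exists c.
exists (ball_code (eps / 2) (finmap.enum_fset D)), (size (finmap.enum_fset D))%:R; split.
- exact: measurable_ball_code.
- by move=> z; rewrite ball_code_ge0 ball_code_le.
- move=> z z' /(ball_code_eq (cov z) (cov z')) [c [cz cz']].
  have := ball_triangle (ball_sym cz) cz'; rewrite -splitr ballEmdist.
  exact.
Qed.

End Code.

Lemma L2_bounded {R : realType} {d} {Y : measurableType d} (nu : probability Y R)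
    (f : Y -> R) (C : R) :
  measurable_fun setT f -> (forall z, 0 <= f z <= C) ->
  L2 nu (fun z => (f z)%:C%C).
Proof.
move=> mf fC; split => //=.
rewrite /L2norm unlock; apply: poweR_lty.
apply: (@le_lt_trans _ _ (\int[nu]_x (cst ((C ^+ 2)%:E) x))%E).
  apply: ge0_le_integral => //.
  - by move=> x _; exact: poweR_ge0.
  - apply: (measurableT_comp (measurable_poweR _)).
    have -> : (fun x => `|(normc (f x)%:C%C)%:E|%E) = (fun x => (`|f x|)%:E).
      by apply/funext => x; rewrite normc_real /= normr_id.
    by apply/measurable_EFinP; exact: measurableT_comp.
  - move=> x _; have /andP[f0 fle] := fC x.
    rewrite /cst normc_real abse_EFin normr_id ger0_norm// poweR_EFin lee_fin.
    by rewrite powR_mulrn// lerXn2r ?nnegrE// (le_trans f0).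
by rewrite integral_cst// [X in (_ * X)%E](@probability_setT _ _ _ nu) mule1 ltry.
Qed.

(** * The Feldman-Katok pseudometric on a large compact set *)

Section Assembly.
Context {R : realType} {X : pmetricType R}.
Variables (mu : probability (borel X) R).

Lemma continuous_measurable_borel (T : X -> X) : continuous T ->
  measurable_fun setT (T : borel X -> borel X).
Proof.
move=> cT; apply: (@measurability _ _ (borel X) (borel X) setT T (@open X)) => //.
move=> _ [V oV <-]; rewrite setTI; apply: open_measurable_borel.
by move/continuousP : cT; apply.
Qed.

(** Inner regularity: the trace of [E] on a closed set where it is relatively clopen is
    closed. *)
Lemma closed_subset_nearly (E : set (borel X)) (s t : R) : measurable E ->
  (mu (~` E) <= s%:E)%E -> 0 < t ->
  exists M : set (borel X), [/\ closed (M : set X), M `<=` E & (mu (~` M) <= (s + t)%:E)%E].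
Proof.
move=> mE Es t0; have [M [cM muM lM]] := nearly_locally_constant mu mE t0.
exists (M `&` E); split => //.
  move=> x clx.
  have Mx : M x by apply: cM => V /clx[z [[Mz _] Vz]]; exists z.
  by split => //; have [z [[Mz Ez] h]] := clx _ (lM x Mx); apply/h.
rewrite setCI setUC EFinD; apply: le_trans (measureU2 _ _ _) _; last exact: leeD.
  exact: measurableC.
by apply: measurableC; exact: closed_measurable_borel.
Qed.

(** The eigenvalue equation, known almost everywhere, is turned into an equation off a
    null set [N] of [mu]: the orbits that meet [N] can then be discarded at once. *)
Lemma eigenfunction_contraction (T : X -> X) (A : set (borel X)) (mA : measurable A)
    (e : borel X -> R[i]) :
  measurable_fun setT (T : borel X -> borel X) -> invariant_measure T mu ->
  (0 < mu A)%E ->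
  eigenfunction (induced_measure mu mA) (induced_map T A) e ->
  measurable_complex e /\
  exists (l : R[i]) (N : set (borel X)), [/\ measurable N, mu N = 0%E, normc l <= 1 &
    forall x, A x -> ~ N x -> e (induced_map T A x) = l * e x].
Proof.
move=> mT Tmu A0 [[mr mi _] ne0 [l el]].
split; first by split.
have [N [mN N0 eN]] := induced_negligible A0 el.
exists l, N; split => //; last first.
  by move=> x Ax nNx; apply: contrapT => ne; apply: nNx; apply: eN; split.
rewrite leNgt; apply/negP => l1; apply: ne0.
apply: negligible_induced => //.
apply: (@eigenvalue_le1 _ _ mu T mT Tmu A N e l) => //.
by move=> x Ax nNx; apply: contrapT => ne; apply: nNx; apply: eN; split.
Qed.

End Assembly.

Section CoreEstimate.
Context {R : realType} {X : pmetricType R}.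
Variables (mu : probability (borel X) R) (T : X -> X).
Hypothesis X_compact : compact [set: X].
Hypothesis T_continuous : continuous T.
Hypothesis mu_invariant : invariant_measure T mu.

(** For points [x], [y] of the closed set produced here, the orbits spend at most a
    proportion [k] of the time outside the set [G] where [g] approximates [phi], and
    [g] takes close values at the [i]-th visits of [x] and [y] to [A], so that
    [d_FK_le_visits] applies. *)
Lemma nearly_d_FK (eps : R) : 0 < eps ->
  (forall kappa : R, 0 < kappa ->
      exists (A : set (borel X)) (mA : measurable A),
        [/\ ((1 - kappa)%:E < mu A)%E, (0 < mu A)%E &
          discrete_spectrum (induced_measure mu mA) (induced_map T A)]) ->
  nearly mu (fun M => exists2 delta : R, 0 < delta &
    forall x y, M x -> M y -> mdist x y < delta -> d_FK T x y < eps).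
Proof.
move=> eps0 almost tau tau0.
have mT := continuous_measurable_borel T_continuous.
(* A match omits a proportion at most [2 * k] of the times, to be less than
   [eps / 2]; [k < 1] prevents a point from being outside [G] at time 0. *)
pose k : R := Num.min (eps / 8) (1 / 2).
have k0 : 0 < k by rewrite lt_min !divr_gt0.
have ke : 2 * k < eps / 2.
  have : k <= eps / 8 by rewrite ge_min lexx.
  by move: eps0; lra.
have k1 : k < 1.
  have : k <= 1 / 2 by rewrite ge_min lexx orbT.
  by lra.
(* [~` A] and the points of [A] where [g] is far from [phi] have measure at most [r];
   the maximal inequality at level [k] turns [2 * r] into [tau / 2]. *)
pose r : R := k * tau / 4.
have r0 : 0 < r by rewrite divr_gt0// mulr_gt0.
have [A [mA [muA A0 dsA]]] := almost r r0.
have [phi [C [mphi phiC phi_sep]]] := exists_code X_compact (divr_gt0 eps0 (ltr0Sn R 1)).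
(* Chebyshev's inequality for the level 1/4 gives [b ^+ 2 / (1 / 4) ^+ 2 = r]. *)
pose b : R := Num.sqrt (r / 16).
have b0 : 0 < b by rewrite sqrtr_gt0 divr_gt0.
have [n [c [e [eE gU]]]] := dsA _ (L2_bounded (induced_measure mu mA) mphi phiC) b b0.
have {}eE i := eigenfunction_contraction mT mu_invariant A0 (eE i).
have me i : measurable_complex (e i) by have [] := eE i.
have /choice[l /choice[N HN]] : forall i : 'I_n, exists (l : R[i]) (N : set (borel X)),
    [/\ measurable N, mu N = 0%E, normc l <= 1 &
    forall x, A x -> ~ N x -> e i (induced_map T A x) = l * e i x].
  by move=> i; have [] := eE i.
pose g x := \sum_(i < n) c i * e i x.
have mg : measurable_complex g.
  by apply: measurable_complex_sum => i; exact: measurable_complexZ.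
have mphiC : measurable_complex (fun x => (phi x)%:C%C) by split.
have q0 : 0 < 1 / 4 :> R by rewrite divr_gt0.
have [mU muU] := L2_chebyshev (measurable_complexB mphiC mg) q0 (ltW b0) gU.
set U : set (borel X) := [set x | _] in mU muU.
have {muU} muU : (mu (U `&` A) <= r%:E)%E.
  apply: le_trans (le_induced_measure mA A0 U) _.
  apply: le_trans muU _; rewrite lee_fin /b sqr_sqrtr; last by rewrite divr_ge0// ltW.
  by rewrite ler_pdivrMr ?exprn_gt0//; lra.
pose G : set (borel X) := A `\` U.
have mG : measurable G by exact: measurableD.
have muG : (mu (~` G) <= (2 * r)%:E)%E.
  have -> : ~` G = ~` A `|` (U `&` A).
    apply/seteqP; split => x.
      by move=> nG; have [Ax|] := pselect (A x); [right|left] => //; split => //;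
        apply: contrapT => nU; apply: nG.
    by move=> [nA [/nA//]|[Ux _] [_ /(_ Ux)]].
  have mUA : measurable (U `&` A) by exact: measurableI.
  apply: le_trans (measureU2 mu (measurableC mA) mUA) _.
  suff nA : (mu (~` A) <= r%:E)%E by rewrite mulr_natl mulr2n EFinD leeD.
  rewrite probability_setC// -(fineK (fin_num_measure mu _ mA)) -EFinB lee_fin.
  have : 1 - r < fine (mu A) by rewrite -lte_fin fineK// fin_num_measure.
  by lra.
have [mZ muZ] := maximal_ergodic_inequality mT mu_invariant (measurableC mG) k0.
set Z := \bigcup_N0 _ in mZ muZ.
(* The union of the finitely many null sets [N i], indexed by [nat]; then [O'] is the
   set of points whose orbit meets it. *)
pose N1 : set (borel X) := \bigcup_i (if insub i is Some i' then N i' else set0).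
have mN1 : measurable N1.
  apply: bigcup_measurable => i _; case: insubP => [i' _ _|_] //.
  by have [] := HN i'.
have N10 : mu N1 = 0%E.
  apply/negligibleP => //; apply: negligible_bigcup => i.
  case: insubP => [i' _ _|_]; last exact: negligible_set0.
  by have [mNi Ni0 _ _] := HN i'; exists (N i'); split.
have [mO O0] := orbitwise_null mT mu_invariant mN1 N10.
set O' := \bigcup_t _ in mO O0.
pose E : set (borel X) := ~` (Z `|` O').
have mE : measurable E by apply: measurableC; exact: measurableU.
have muE : (mu (~` E) <= (tau / 2)%:E)%E.
  rewrite /E setCK; apply: le_trans (measureU2 mu mZ mO) _.
  rewrite [X in (_ + X)%E]O0 adde0; apply: le_trans muZ _.
  have : (k^-1%:E * mu (~` G) <= k^-1%:E * (2 * r)%:E)%E.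
    by apply: lee_wpmul2l => //; rewrite lee_fin invr_ge0 ltW.
  move/le_trans; apply; rewrite -EFinM lee_fin /r.
  by rewrite ler_pdivrMl//; lra.
have tau40 : 0 < tau / 4 by rewrite divr_gt0.
have [M0 [cM0 M0E muM0]] := closed_subset_nearly mE muE tau40.
pose u (ib : 'I_n * bool) (x : borel X) :=
  if ib.2 then complex.Re (e ib.1 x) else complex.Im (e ib.1 x).
have [||M1 [cM1 muM1 cont]] := @nearly_all _ _ mu ('I_n * bool)%type
  (fun ib M => continuous_along M (u ib)) _ _ _ tau40.
- by move=> i M M' sM cM x /sM Mx eta eta0; apply: filterS (cM x Mx eta eta0) => y h /sM.
- by move=> [i []]; apply: nearly_continuous; have [] := me i.
exists (M0 `&` M1); split.
- exact: closedI.
- rewrite setCI.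
  apply: le_trans (measureU2 mu _ _) _; [| |].
  + by apply: measurableC; exact: closed_measurable_borel.
  + by apply: measurableC; exact: closed_measurable_borel.
  have -> : tau = (tau / 2 + tau / 4) + tau / 4 by lra.
  by rewrite EFinD leeD.
have cptM1 : compact (M1 : set X) by exact: (subclosed_compact cM1 X_compact).
pose s : R := \sum_(i < n) normc (c i).
have s0 : 0 <= s by apply: sumr_ge0 => i _; exact: normc_ge0.
(* The real and imaginary parts of each [e i] vary by at most [eta], so [g] varies by at
   most [s * (2 * eta) <= 1 / 4]. *)
pose eta : R := 1 / (8 * (1 + s)).
have eta0 : 0 < eta by rewrite divr_gt0// mulr_gt0// ltr_pwDl.
have [delta [delta0 Hd]] : exists delta : R, 0 < delta /\
    forall ib x y, M1 x -> M1 y -> mdist x y < delta -> `|u ib x - u ib y| < eta.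
  have unif ib : \forall d \near 0^'+, forall x y, M1 x -> M1 y ->
      mdist x y < d -> `|u ib x - u ib y| < eta.
    have [d d0 Hd] := continuous_along_unif cptM1 (cont ib) eta0.
    apply: filterS (nbhs_right_lt d0) => d' d'd x y Mx My xy.
    by apply: Hd => //; exact: lt_trans d'd.
  exact: filter_ex (filterI (nbhs_right_gt 0) (filter_forall _ unif)).
exists delta => // x y [Mx M1x] [My M1y] xy.
have bad z : E z -> forall m, (visits T (~` G) m z)%:R <= k * m%:R.
  move=> Ez m; have [->|m0] := posnP m; first by rewrite visits0 mulr0.
  rewrite leNgt; apply/negP => h; apply: Ez; left.
  by exists m => //; exists m; split.
have EA z : E z -> A z.
  move=> Ez; apply: contrapT => nA; have := bad z Ez 1%N.
  rewrite visitsS visits0 mem_set ?mulr1; last by move=> [].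
  by rewrite leNgt k1.
have eig z i t : E z -> A (iter t T z) -> e i (iter t T z) = l i ^+ visits T A t z * e i z.
  move=> Ez At; apply: eigen_visits => //; last exact: EA.
  move=> t' At'; have [_ _ _ Hi] := HN i; apply: Hi => // Nt'; apply: Ez; right.
  by exists t' => //; exists i => //; rewrite valK.
have [Ex Ey] := (M0E _ Mx, M0E _ My).
apply: (@le_lt_trans _ _ (eps / 2)); last by move: eps0; lra.
apply: (@d_FK_le_visits _ _ T A G _ k) => //.
- by move=> z [].
- by rewrite divr_gt0.
- exact: bad.
- exact: bad.
move=> t t' [At nUt] [At' nUt'] vv; apply: phi_sep.
(* The eigenvalues have modulus at most 1 and both visits have the same rank: the
   bound on [e i x - e i y] persists at these visits. *)
have gg : normc (g (iter t T x) - g (iter t' T y)) <= 1 / 4.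
  rewrite /g -sumrB; apply: le_trans (ler_normc_sum _ _) _.
  apply: (@le_trans _ _ (\sum_(i < n) normc (c i) * (2 * eta))).
    apply: ler_sum => i _; rewrite -mulrBr Normc.normcM ler_wpM2l ?normc_ge0//.
    rewrite !eig// vv -mulrBr Normc.normcM normcX.
    have [_ _ l1 _] := HN i.
    have : normc (e i x - e i y) <= 2 * eta.
      apply: le_trans (ler_normc_ReIm _) _.
      rewrite (raddfB (@complex.Re R)) (raddfB (@complex.Im R)) mulr_natl mulr2n.
      by apply: lerD; apply: ltW; [exact: (Hd (i, true))|exact: (Hd (i, false))].
    apply: le_trans; rewrite ler_piMl ?normc_ge0// exprn_ile1 ?normc_ge0//.
  rewrite -mulr_suml -/s /eta.
  rewrite mulrCA mulrA mulrA mulr1 ler_pdivrMr; last by rewrite mulr_gt0// ltr_pwDl.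
  by lra.
have ht : normc ((phi (iter t T x))%:C%C - g (iter t T x)) < 1 / 4.
  by rewrite ltNge; apply/negP.
have ht' : normc ((phi (iter t' T y))%:C%C - g (iter t' T y)) < 1 / 4.
  by rewrite ltNge; apply/negP.
rewrite -normc_real.
pose p : R[i] := (phi (iter t T x))%:C%C; pose p' : R[i] := (phi (iter t' T y))%:C%C.
have -> : (phi (iter t T x) - phi (iter t' T y))%:C%C = p - p' by exact: rmorphB.
(* Three terms of norm at most 1/4, the first and the last less than 1/4. *)
have -> : p - p' = (p - g (iter t T x)) +
    ((g (iter t T x) - g (iter t' T y)) + (- (p' - g (iter t' T y)))).
  by rewrite opprB addrA !subrKA.
have nN (z : R[i]) : normc (- z) = normc z by exact: normcN.
apply: le_lt_trans (ler_normcD _ _) _.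
have := ler_normcD (g (iter t T x) - g (iter t' T y)) (- (p' - g (iter t' T y))).
rewrite nN; move: ht ht' gg; rewrite -/p -/p'.
lra.
Qed.

End CoreEstimate.

Unset Implicit Arguments.

Theorem theorem4p7 (R : realType) (X : pmetricType R) (T : X -> X)
    (mu : probability (borel X) R)
    (X_compact : compact [set: X])
    (T_continuous : continuous T)
    (mu_invariant : invariant_measure T mu)
    (almost_discrete : forall eps : R, 0 < eps ->
      exists (A : set (borel X)) (mA : measurable A),
        [/\ ((1 - eps)%:E < mu A)%E, (0 < mu A)%E &
          discrete_spectrum (induced_measure mu mA) (induced_map T A)]) :
  FK_equicontinuous T mu.
Proof.
move=> tau tau0; have tau20 : 0 < tau / 2 by rewrite divr_gt0.
have [||M [cM muM HM]] := @nearly_all _ _ mu nat (fun k M =>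
    exists2 delta : R, 0 < delta & forall x y, M x -> M y ->
      mdist x y < delta -> d_FK T x y < k.+1%:R^-1) _ _ _ tau20.
- move=> k M M' sM [delta delta0 Hd]; exists delta => // x y /sM Mx /sM My.
  exact: Hd.
- by move=> k; apply: nearly_d_FK => //; rewrite invr_gt0 ltr0n.
have mM : measurable M by exact: closed_measurable_borel.
exists M; split.
- exact: subclosed_compact cM X_compact _.
- move: muM; rewrite probability_setC// -(fineK (fin_num_measure mu _ mM)).
  rewrite -EFinB lee_fin lte_fin; move: tau0; lra.
- move=> eps eps0; have [k _ keps] := near_infty_natSinv_lt (PosNum eps0).
  have [delta delta0 Hd] := HM k; exists delta => // x y Mx My xy.
  by apply: lt_trans (Hd x y Mx My xy) _; exact: keps (leqnn k).
Qed.
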